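(* Consider the Riemannian cone $\mathcal{C}(\mathfrak{H})=(\mathfrak{H}\times\mathbb{R}_{>0},g_r)$ with the orthonormal frame $\{X_r,Y_r,T_r,\partial_r\}$. The sectional curvatures of all distinguished planes vanish besides that of the distinguished plane spanned by $X_r,Y_r$, for which $$K_r(X_r,Y_r)=-\frac{4}{r^2}<0.$$
   Context: $\mathfrak{H}=\mathbb{C}\times\mathbb{R}$ is the Heisenberg group with coordinates $(z=x+iy,t)$ and multiplication $(z,t)*(w,s)=(z+w,t+s+2\Im(z\overline w))$. Put $X=\partial_x+2y\,\partial_t$, $Y=\partial_y-2x\,\partial_t$, $T=\partial_t$, $\widetilde T=2T$, $\omega=dt+2x\,dy-2y\,dx$, $g=dx^2+dy^2+\tfrac14\omega^2$. On $\mathfrak{H}\times\mathbb{R}_{>0}$, with coordinate $r$ on the second factor, $g_r=dr^2+r^2g$, with orthonormal frame $X_r=\tfrac1rX$, $Y_r=\tfrac1rY$, $T_r=\tfrac1r\widetilde T$, $\partial_r=d/dr$. The distinguished planes are the planes spanned by two distinct vectors of the frame $\{X_r,Y_r,T_r,\partial_r\}$. $K_r$ denotes the (usual) sectional curvature of $g_r$. *)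

(* Defs.v *)
From HB Require Import structures.
From mathcomp Require Import all_boot all_order all_algebra.
From mathcomp Require Import all_classical all_reals all_analysis.
Import Order.TTheory GRing.Theory Num.Theory.
Import numFieldNormedType.Exports.
Set Implicit Arguments.
Unset Strict Implicit.
Unset Printing Implicit Defensive.
Local Open Scope ring_scope.

(* Points of (an open part of) R^(n+1), tangent vectors (components in the
   coordinate basis) and covectors (coefficients of the dx_i) are all row
   vectors; 'e_ i is the i-th basis vector.  A metric is the matrix field
   p |-> (g_ij(p)).  Values outside the coordinate domain are irrelevant:
   every operation below only uses the germ of g at p. *)
Definition vfield (R : realType) (n : nat) := 'rV[R]_n.+1 -> 'rV[R]_n.+1.
Definition metric (R : realType) (n : nat) := 'rV[R]_n.+1 -> 'M[R]_n.+1.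

Section Curvature.
Variables (R : realType) (n : nat) (g : metric R n).
Implicit Types (p u v w : 'rV[R]_n.+1) (i j k l m : 'I_n.+1).

Definition partial i (f : 'rV[R]_n.+1 -> R) p : R := 'D_('e_ i) f p.

Definition inner p u v : R := (u *m g p *m v^T) 0 0.

(* Levi-Civita connection: nabla_{d_i} d_j = \sum_k (christoffel k i j) d_k. *)
Definition christoffel k i j p : R :=
  2^-1 * \sum_l invmx (g p) k l *
    (partial i (fun q => g q j l) p + partial j (fun q => g q i l) p
     - partial l (fun q => g q i j) p).

(* R(d_i, d_j) d_k = \sum_l (riemann l i j k) d_l, with the convention
   R(U, V) W = nabla_U nabla_V W - nabla_V nabla_U W - nabla_[U, V] W. *)
Definition riemann l i j k p : R :=
  partial i (christoffel l j k) p - partial j (christoffel l i k) p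
  + \sum_m (christoffel l i m p * christoffel m j k p
            - christoffel l j m p * christoffel m i k p).

Definition curvature p u v w : 'rV[R]_n.+1 :=
  \row_l \sum_i \sum_j \sum_k riemann l i j k p * u 0 i * v 0 j * w 0 k.

(* Sectional curvature at p of the plane spanned by the linearly independent
   tangent vectors u and v. *)
Definition sectional p u v : R :=
  inner p (curvature p u v v) u /
  (inner p u u * inner p v v - inner p u v ^+ 2).

End Curvature.

Section Cone.
Variables (R : realType) (n : nat).

(* The last coordinate is the radial one. *)
Definition cone_pt (p : 'rV[R]_n.+1) (r : R) : 'rV[R]_(n.+1 + 1) :=
  row_mx p r%:M.

Definition base (q : 'rV[R]_(n.+1 + 1)) : 'rV[R]_n.+1 := lsubmx q.
Definition radius (q : 'rV[R]_(n.+1 + 1)) : R := rsubmx q 0 0.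

(* dr^2 + r^2 g *)
Definition cone_metric (g : metric R n) : metric R (n + 1) :=
  fun q => block_mx (radius q ^+ 2 *: g (base q)) 0 0 1%:M.

(* The field r^-1 U on the cone, for a field U on the base. *)
Definition cone_lift (U : vfield R n) : vfield R (n + 1) :=
  fun q => row_mx ((radius q)^-1 *: U (base q)) 0.

Definition cone_dr : vfield R (n + 1) :=
  fun=> row_mx (0 : 'rV[R]_n.+1) 1%:M.

End Cone.

(* The Heisenberg group C x R in the real coordinates (x, y, t), z = x + i y. *)
Section Heisenberg.
Variable R : realType.
Implicit Type p : 'rV[R]_3.

Definition cx p : R := p 0 0.
Definition cy p : R := p 0 1.

Definition heisX : vfield R 2 := fun p => 'e_0 + (2 * cy p) *: 'e_2.
Definition heisY : vfield R 2 := fun p => 'e_1 - (2 * cx p) *: 'e_2.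
Definition heisT : vfield R 2 := fun=> 'e_2.
Definition heisTt : vfield R 2 := fun p => 2 *: heisT p.

Definition omega p : 'rV[R]_3 :=
  'e_2 + (2 * cx p) *: 'e_1 - (2 * cy p) *: 'e_0.

(* The square of a covector a, as a bilinear form, has matrix a^T *m a. *)
Definition sqform (a : 'rV[R]_3) : 'M[R]_3 := a^T *m a.

Definition heis_metric : metric R 2 :=
  fun p => sqform 'e_0 + sqform 'e_1 + 4^-1 *: sqform (omega p).

Definition coneX : vfield R 3 := cone_lift heisX.
Definition coneY : vfield R 3 := cone_lift heisY.
Definition coneT : vfield R 3 := cone_lift heisTt.
Definition coneR : vfield R 3 := @cone_dr R 2.

Definition cone_frame (q : 'rV[R]_4) : seq 'rV[R]_4 :=
  [:: coneX q; coneY q; coneT q; coneR q].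

Definition heis_cone_metric : metric R 3 := cone_metric heis_metric.

End Heisenberg.

(* Main.v *)
Require Import Defs.
From mathcomp Require Import all_boot all_order all_algebra.
From mathcomp Require Import all_classical all_reals all_analysis.
From mathcomp Require Import ring.
Import Order.TTheory GRing.Theory Num.Theory.
Import numFieldNormedType.Exports.
Local Open Scope ring_scope.

(** A plane of the cone C(M) tangent to the base has sectional curvature
    (K - 1) / r^2, where K is the curvature of that plane in (M, g), and a plane
    containing the radial direction is flat.  So the statement amounts to
    the values K(X, Y) = -3 and K(X, 2T) = K(Y, 2T) = 1 on the Heisenberg group,
    for which (K - 1) / r^2 is -4 / r^2, 0 and 0.

    The cone: the Levi-Civita equations (christoffel_unique) give its
    Christoffel symbols in terms of those of g (cone_christoffelE); apart from
    the symbols of g itself, they are delta / r and - r g_ij.  The products of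
    these two contribute the curvature - (g_jk delta_li - g_ik delta_lj), that is
    the - 1 above (riemann_hhhh, base_curvature_cone, sectional_cone_lift).

    The Heisenberg group: put theta = omega / 2 and let rot be the
    endomorphism field with rot X = Y, rot Y = - X, rot T = 0.  Then
    g = dx^2 + dy^2 + theta^2, d theta is twice the area form dx /\ dy, and
    g (rot u) w = area u w.  Hence the connection is the flat one of
    the coordinates plus the symmetric tensor
    (u, v) |-> theta(u) rot v + theta(v) rot u (heis_christoffelE).
    As theta and rot depend affinely on the point, differentiating once more is
    immediate, and the curvature satisfies
      g (R(u, v) v) u = |theta(u) v - theta(v) u|^2 - 3 area(u, v)^2,
    where |w|^2 = w_x^2 + w_y^2 (heis_sectional_num).  Evaluating this on
    the frame gives the three values. *)

(** * Derivatives along lines *)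

(** A directional derivative depends only on the values on a line; hence a partial
    derivative on the cone is one on the base or on the half-line of radii. *)
Lemma derive_eq_along {R : realType} {V W : normedModType R} (f : V -> R)
    (g : W -> R) (a v : V) (b w : W) :
  (forall h : R, f (h *: v + a) = g (h *: w + b)) -> 'D_v f a = 'D_w g b.
Proof.
move=> fg; have := fg 0; rewrite !scale0r !add0r => fa.
rewrite /derive (_ : (fun h => _) =
  (fun h => h^-1 *: ((g \o shift b) (h *: w) - g b)))//.
by apply/funext => h /=; rewrite fg fa.
Qed.

Lemma is_derive_affine {R : realType} {V : normedModType R} (f : V -> R)
    (a v : V) (d : R) :
  (forall h : R, f (h *: v + a) = h * d + f a) -> is_derive a v f d.
Proof.
move=> fh.
have E : (fun h => h^-1 *: ((f \o shift a) (h *: v) - f a)) =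
    (fun h => h^-1 *: ((id \o shift (f a)) (h *: d) - id (f a))).
  by apply/funext => h /=; rewrite fh.
apply: DeriveDef; last by rewrite /derive E; exact: derive_id.
by rewrite /derivable E; exact: derivable_id.
Qed.

(** * Levi-Civita connection and curvature in coordinates *)

Section Metric.
Context {R : realType} {n : nat} (g : metric R n).
Implicit Types (p u v w : 'rV[R]_n.+1) (i j k l m : 'I_n.+1).

(** The Christoffel symbols with the upper index lowered: the form of their
    definition that does not mention the inverse matrix of the metric. *)
Lemma christoffel_lower i j l p : g p \in unitmx ->
  2 * (\sum_k g p l k * christoffel g k i j p) =
  partial i (fun q => g q j l) p + partial j (fun q => g q i l) p
  - partial l (fun q => g q i j) p.
Proof.
move=> gU.
pose c l := partial i (fun q => g q j l) p + partial j (fun q => g q i l) p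
  - partial l (fun q => g q i j) p.
rewrite -[RHS]/(c l).
transitivity ((g p *m (invmx (g p) *m \col_l c l)) l 0); last first.
  by rewrite mulmxA mulmxV// mul1mx mxE.
rewrite mxE mulr_sumr; apply: eq_bigr => k _.
rewrite !mxE /christoffel mulrCA; congr (_ * _).
rewrite mulrA mulfV ?mul1r ?pnatr_eq0//.
by apply: eq_bigr => m _; rewrite mxE.
Qed.

(** Solving the equations of the previous lemma is how the symbols of a given
    metric are found: a candidate is checked without inverting the metric. *)
Lemma christoffel_unique (G : 'I_n.+1 -> R) i j p : g p \in unitmx ->
  (forall l, partial i (fun q => g q j l) p + partial j (fun q => g q i l) p
    - partial l (fun q => g q i j) p = 2 * (\sum_k g p l k * G k)) ->
  forall k, christoffel g k i j p = G k.
Proof.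
move=> gU cG k.
suff : \col_k christoffel g k i j p = \col_k G k.
  by move/colP/(_ k); rewrite !mxE.
apply: (can_inj (mulKmx gU)); apply/colP => l; rewrite !mxE.
apply: (@mulfI _ 2); first by rewrite pnatr_eq0.
under eq_bigr do rewrite mxE; under [in RHS]eq_bigr do rewrite mxE.
by rewrite christoffel_lower// cG.
Qed.

Lemma innerE p u v : inner g p u v = \sum_i \sum_j g p i j * u 0 i * v 0 j.
Proof.
rewrite /inner mxE exchange_big; apply: eq_bigr => j _ /=.
by rewrite !mxE mulr_suml; apply: eq_bigr => i _; ring.
Qed.

Lemma innerC p u v : (forall i j, g p i j = g p j i) ->
  inner g p u v = inner g p v u.
Proof.
move=> gS; rewrite !innerE exchange_big; apply: eq_bigr => i _.
by apply: eq_bigr => j _; rewrite gS; ring.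
Qed.

Lemma innerZl p s u v : inner g p (s *: u) v = s * inner g p u v.
Proof. by rewrite /inner -!scalemxAl mxE. Qed.

Lemma innerZr p s u v : inner g p u (s *: v) = s * inner g p u v.
Proof. by rewrite /inner linearZ/= -!scalemxAr mxE. Qed.

Lemma innerDr p u v w : inner g p u (v + w) = inner g p u v + inner g p u w.
Proof. by rewrite /inner linearD/= mulmxDr mxE. Qed.

Lemma innerNr p u v : inner g p u (- v) = - inner g p u v.
Proof. by rewrite /inner linearN/= mulmxN mxE. Qed.

Lemma innerBl p u v w : inner g p (u - v) w = inner g p u w - inner g p v w.
Proof. by rewrite /inner !mulmxBl !mxE. Qed.

Lemma curvatureZ p s t u v :
  curvature g p (s *: u) (t *: v) (t *: v) = (s * t ^+ 2) *: curvature g p u v v.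
Proof.
apply/rowP => l; rewrite !mxE mulr_sumr; apply: eq_bigr => i _.
rewrite mulr_sumr; apply: eq_bigr => j _.
by rewrite mulr_sumr; apply: eq_bigr => k _; rewrite !mxE; ring.
Qed.

End Metric.

(** * Curvature of a Riemannian cone *)

Local Notation radius := Defs.radius.

Section ConeCurvature.
Context {R : realType} {n : nat} (g : metric R n).
Implicit Types (p : 'rV[R]_n.+1) (q : 'rV[R]_(n.+1 + 1)) (i j k l m : 'I_n.+1).

Local Notation G := (cone_metric g).
Local Notation partialG := (@partial R (n + 1)).
Local Notation christoffelG := (@christoffel R (n + 1) G).
Local Notation riemannG := (@riemann R (n + 1) G).
Local Notation curvatureG := (@curvature R (n + 1) G).
Local Notation innerG := (@inner R (n + 1) G).
Local Notation sectionalG := (@sectional R (n + 1) G).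
Local Notation hor := (lshift 1).
Local Notation rad := (rshift n.+1 (0 : 'I_1)).

(* The letters h and r in the names below say which indices are horizontal
   (tangent to the base) and which are radial. *)
Lemma cone_metric_hh i j q :
  G q (hor i) (hor j) = radius q ^+ 2 * g (base q) i j.
Proof. by apply: etrans (block_mxEul _ _ _ _ i j) _; rewrite mxE. Qed.

Lemma cone_metric_hr i q : G q (hor i) rad = 0.
Proof. by apply: etrans (block_mxEur _ _ _ _ i 0) _; rewrite mxE. Qed.

Lemma cone_metric_rh i q : G q rad (hor i) = 0.
Proof. by apply: etrans (block_mxEdl _ _ _ _ 0 i) _; rewrite mxE. Qed.

Lemma cone_metric_rr q : G q rad rad = 1.
Proof. by apply: etrans (block_mxEdr _ _ _ _ 0 0) _; rewrite mxE. Qed.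

Lemma base_line_hor h i q : base (h *: 'e_(hor i) + q) = h *: 'e_i + base q.
Proof.
by apply/rowP => j; rewrite !mxE eqxx /= (inj_eq (@lshift_inj _ _)).
Qed.

Lemma radius_line_hor h i q : radius (h *: 'e_(hor i) + q) = radius q.
Proof. by rewrite /Defs.radius !mxE eqxx eq_rlshift mulr0 add0r. Qed.

Lemma base_line_rad h q : base (h *: 'e_rad + q) = base q.
Proof. by apply/rowP => j; rewrite !mxE eq_lrshift andbF mulr0 add0r. Qed.

Lemma radius_line_rad h q : radius (h *: 'e_rad + q) = h *: 1 + radius q.
Proof. by rewrite /Defs.radius !mxE !eqxx. Qed.

Lemma partial_hor (F : R -> 'rV[R]_n.+1 -> R) i q :
  partialG (hor i) (fun q => F (radius q) (base q)) q
  = partial i (F (radius q)) (base q).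
Proof.
apply: derive_eq_along => h.
exact: f_equal2 (radius_line_hor _ _ _) (base_line_hor _ _ _).
Qed.

Lemma partial_rad (F : R -> 'rV[R]_n.+1 -> R) q :
  partialG rad (fun q => F (radius q) (base q)) q
  = 'D_1 (F ^~ (base q)) (radius q).
Proof.
apply: derive_eq_along => h.
exact: f_equal2 (radius_line_rad _ _) (base_line_rad _ _).
Qed.

Hypothesis gU : forall p, g p \in unitmx.
Hypothesis gS : forall p i j, g p i j = g p j i.
Hypothesis gD : forall i j k p, derivable (fun p => g p i j) p 'e_k.

Lemma cone_metric_unit q : radius q != 0 -> G q \in unitmx.
Proof.
move=> q0.
suff : (block_mx (radius q ^+ 2 *: g (base q)) 0 0 1%:M : 'M[R]_(n.+1 + 1))
  \in unitmx by [].
rewrite unitmxE det_ublock det1 mulr1 -unitmxE.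
by rewrite unitmxZ ?unitfE ?expf_neq0.
Qed.

Lemma partial_cst (c : R) (k : 'I_(n + 1).+1) q : partialG k (fun=> c) q = 0.
Proof. exact: derive_cst. Qed.

Lemma partial_hor_metric i j l q :
  partialG (hor l) (fun q => G q (hor i) (hor j)) q
  = radius q ^+ 2 * partial l (fun p => g p i j) (base q).
Proof.
under eq_fun do rewrite cone_metric_hh.
rewrite (partial_hor (fun s p => s ^+ 2 * g p i j)).
by rewrite /partial deriveMl.
Qed.

Lemma partial_rad_metric i j q :
  partialG rad (fun q => G q (hor i) (hor j)) q
  = 2 * (radius q * g (base q) i j).
Proof.
under eq_fun do rewrite cone_metric_hh.
rewrite (partial_rad (fun s p => s ^+ 2 * g p i j)).
have d2 : is_derive (radius q) 1 (@GRing.exp R ^~ 2) (2 * radius q).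
  have -> : @GRing.exp R ^~ 2 = id ^+ 2 by [].
  by apply: is_derive_eq; rewrite expr1 -[LHS]/(_ * _) mulr1.
rewrite (@deriveMr _ _ (@GRing.exp R ^~ 2)) ?derive_val//; ring.
Qed.

(** The covariant derivatives of the coordinate fields on the cone: those of
    the base minus r g_ij d_r between horizontal fields, (1 / r) d_i between d_i
    and d_r, and 0 for d_r with itself. *)
Definition cone_christoffel (k i j : 'I_(n.+1 + 1)) q : R :=
  match fintype.split k, fintype.split i, fintype.split j with
  | inl k, inl i, inl j => christoffel g k i j (base q)
  | inl k, inl i, inr _ | inl k, inr _, inl i => (k == i)%:R / radius q
  | inr _, inl i, inl j => - (radius q * g (base q) i j)
  | _, _, _ => 0
  end.

Let split_hor i : fintype.split (hor i) = inl i.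
Proof. exact: (unsplitK (inl i)). Qed.

Let split_rad : fintype.split rad = inr 0.
Proof. exact: (unsplitK (inr 0)). Qed.

Lemma partial_metric_hr i (k : 'I_(n + 1).+1) q :
   partialG k (fun q => G q (hor i) rad) q = 0.
Proof. by under eq_fun do rewrite cone_metric_hr; exact: partial_cst. Qed.

Lemma partial_metric_rh i (k : 'I_(n + 1).+1) q :
   partialG k (fun q => G q rad (hor i)) q = 0.
Proof. by under eq_fun do rewrite cone_metric_rh; exact: partial_cst. Qed.

Lemma partial_metric_rr (k : 'I_(n + 1).+1) q :
   partialG k (fun q => G q rad rad) q = 0.
Proof. by under eq_fun do rewrite cone_metric_rr; exact: partial_cst. Qed.

Lemma sum_pick (F : 'I_n.+1 -> R) l : \sum_i (l == i)%:R * F i = F l.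
Proof.
rewrite (bigD1 l)//= eqxx mul1r big1 ?addr0// => i.
by rewrite eq_sym => /negPf->; rewrite mul0r.
Qed.

Lemma sum_delta (F : 'I_n.+1 -> R) (s t : R) i :
  \sum_a s * F a * ((a == i)%:R / t) = s * F i / t.
Proof.
rewrite (bigD1 i)//= eqxx mul1r big1 ?addr0// => a /negPf->.
by rewrite mul0r mulr0.
Qed.

Lemma cone_christoffelE (k i j : 'I_(n.+1 + 1)) q : radius q != 0 ->
  christoffelG k i j q = cone_christoffel k i j q.
Proof.
move=> q0; have := @christoffel_unique R (n + 1) G
  (fun a => cone_christoffel a i j q) i j q (cone_metric_unit _ q0).
move=> H; apply: H => {k} l.
rewrite [X in _ * X](@big_split_ord _ _ _ n.+1 1) /= big_ord1.
rewrite -[ord0]/(0 : 'I_1) /cone_christoffel.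
(* The eight cases come in the order of (l, i, j), with r after h. *)
case: (@split_ordP n.+1 1 l) => {}l ->; case: (@split_ordP n.+1 1 i) => {}i ->;
  case: (@split_ordP n.+1 1 j) => {}j ->; rewrite ?ord1 ?split_rad ?split_hor /=.
all: rewrite ?partial_hor_metric ?partial_rad_metric ?partial_metric_hr
  ?partial_metric_rh ?partial_metric_rr ?cone_metric_hr ?cone_metric_rr.
- under eq_bigr do rewrite cone_metric_hh split_hor -mulrA.
  rewrite -mulr_sumr mul0r addr0 mulrCA christoffel_lower//.
  by rewrite mulrBr mulrDr.
- under eq_bigr do rewrite cone_metric_hh split_hor.
  rewrite sum_delta mulr0 addr0 add0r subr0 (gS _ l).
  by field.
- under eq_bigr do rewrite cone_metric_hh split_hor.
  rewrite sum_delta mulr0 !addr0 subr0 (gS _ l).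
  by field.
- under eq_bigr do rewrite split_hor mulr0.
  by rewrite big1// !(mulr0, addr0, subr0).
- under eq_bigr do rewrite cone_metric_rh mul0r.
  by rewrite big1// !add0r mul1r mulrN.
- under eq_bigr do rewrite cone_metric_rh mul0r.
  by rewrite big1// !(mulr0, addr0, subr0).
- under eq_bigr do rewrite cone_metric_rh mul0r.
  by rewrite big1// !(mulr0, addr0, subr0).
- under eq_bigr do rewrite cone_metric_rh mul0r.
  by rewrite big1// !(mulr0, addr0, subr0).
Qed.

(** The formula for the symbols holds off the apex, hence on a neighborhood of q,
    which is enough to differentiate it. *)
Lemma partial_christoffel (m k i j : 'I_(n.+1 + 1)) q : radius q != 0 ->
  partialG m (christoffelG k i j) q =
  partialG m (cone_christoffel k i j) q.
Proof.
move=> q0; apply: near_eq_derive.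
have /cvgr_neq0 : (radius q' @[q' --> q] --> radius q)%classic.
  have := @coord_continuous R 1 (n.+1 + 1) 0 rad q.
  rewrite /continuous_at /= => H.
  by under eq_fun do rewrite /Defs.radius mxE; rewrite /Defs.radius mxE.
move=> /(_ q0); apply: filterS => q' q'0.
exact: cone_christoffelE.
Qed.

(** The correction is minus the tensor of constant curvature 1: it is the r-term
    of the sum over m, where a symbol delta / r meets a symbol - r g, so that r
    cancels. *)
Lemma riemann_hhhh l i j k q : radius q != 0 ->
  riemannG (hor l) (hor i) (hor j) (hor k) q =
  riemann g l i j k (base q)
  - ((l == i)%:R * g (base q) j k - (l == j)%:R * g (base q) i k).
Proof.
move=> q0; rewrite /riemann !partial_christoffel//.
rewrite (@big_split_ord _ _ _ n.+1 1) /= big_ord1.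
under eq_bigr do rewrite !cone_christoffelE// /cone_christoffel !split_hor.
rewrite !cone_christoffelE// /cone_christoffel !split_hor !split_rad.
rewrite !(partial_hor (fun _ => christoffel _ _ _ _)) -[RHS]addrA.
congr (_ + (_ + _)).
by field.
Qed.

(** Here - d_r (1 / r) = 1 / r^2 cancels the quadratic term - (1 / r)^2. *)
Lemma riemann_hhrr l i q : radius q != 0 ->
  riemannG (hor l) (hor i) rad rad q = 0.
Proof.
move=> q0; rewrite /riemann !partial_christoffel//.
rewrite (@big_split_ord _ _ _ n.+1 1) /= big_ord1.
under eq_bigr do
  rewrite !cone_christoffelE// /cone_christoffel !split_hor !split_rad.
rewrite !cone_christoffelE// /cone_christoffel !split_hor !split_rad.
rewrite partial_cst (partial_rad (fun s _ => (l == i)%:R / s)).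
rewrite deriveMl; last exact: derivableV.
rewrite deriveV// derive_id.
under eq_bigr do rewrite mulr0 sub0r.
rewrite sumrN; under eq_bigr do rewrite [X in X * _]mulrC.
rewrite (sum_delta (fun a => (l == a)%:R)) -[X in _ * X]/(_ * _).
by field.
Qed.

(** Here d_r (- r g_jk) = - g_jk cancels the quadratic term (1 / r) r g_jk. *)
Lemma riemann_rrhh j k q : radius q != 0 ->
  riemannG rad rad (hor j) (hor k) q = 0.
Proof.
move=> q0; rewrite /riemann !partial_christoffel//.
rewrite (@big_split_ord _ _ _ n.+1 1) /= big_ord1.
under eq_bigr do
  rewrite !cone_christoffelE// /cone_christoffel !split_hor !split_rad.
rewrite !cone_christoffelE// /cone_christoffel !split_hor !split_rad.
rewrite partial_cst (partial_rad (fun s p => - (s * g p j k))).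
under eq_fun do rewrite -mulrN.
rewrite deriveMr// derive_id.
under eq_bigr do rewrite mul0r sub0r mulNr opprK.
rewrite sum_delta.
by field.
Qed.

Let sum_hor (F : 'I_(n.+1 + 1) -> R) :
  F rad = 0 -> \sum_i F i = \sum_i F (hor i).
Proof. by move=> F0; rewrite big_split_ord/= big_ord1 F0 addr0. Qed.

Let sum_rad (F : 'I_(n.+1 + 1) -> R) :
  (forall i, F (hor i) = 0) -> \sum_i F i = F rad.
Proof. by move=> F0; rewrite big_split_ord/= big_ord1 big1 ?add0r. Qed.

Local Notation vert := (row_mx (0 : 'rV[R]_n.+1) (1%:M : 'M[R]_1)).
Implicit Types (a b c : 'rV[R]_n.+1) (w : 'rV[R]_(n.+1 + 1)).

Let row_hh a i :
  @fun_of_matrix R 1 (n + 1).+1 (row_mx a (0 : 'M[R]_1)) 0 (hor i) = a 0 i.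
Proof. exact: row_mxEl. Qed.

Let row_hr a :
  @fun_of_matrix R 1 (n + 1).+1 (row_mx a (0 : 'M[R]_1)) 0 rad = 0.
Proof. by apply: etrans (row_mxEr _ _ _ _) _; rewrite mxE. Qed.

Let row_rh i : @fun_of_matrix R 1 (n + 1).+1 vert 0 (hor i) = 0.
Proof. by apply: etrans (row_mxEl _ _ _ _) _; rewrite mxE. Qed.

Lemma inner_cone_hor w a q :
  innerG q w (row_mx a 0) = radius q ^+ 2 * inner g (base q) (base w) a.
Proof.
rewrite /inner -[w in LHS]hsubmxK.
have /(congr1 (fun A => (A *m (row_mx a 0)^T) 0 0)) :=
  @mul_row_block R 1 n.+1 1 n.+1 1 (lsubmx w) (rsubmx w)
    (radius q ^+ 2 *: g (base q)) 0 0 1%:M.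
move=> E; apply: etrans E _.
rewrite tr_row_mx mul_row_col trmx0 !mulmx0 !addr0 -!scalemxAr -!scalemxAl.
by rewrite mxE.
Qed.

Lemma inner_cone_rad w q : innerG q w vert = radius w.
Proof.
rewrite /inner -[w in LHS]hsubmxK.
have /(congr1 (fun A => (A *m vert^T) 0 0)) :=
  @mul_row_block R 1 n.+1 1 n.+1 1 (lsubmx w) (rsubmx w)
    (radius q ^+ 2 *: g (base q)) 0 0 1%:M.
move=> E; apply: etrans E _.
by rewrite tr_row_mx mul_row_col trmx0 trmx1 !mulmx0 !mulmx1 !add0r.
Qed.

(** Only the horizontal part of R(u, v) v matters for the curvature of a
    horizontal plane, since it is paired with a horizontal vector. *)
Lemma base_curvature_cone a b c q : radius q != 0 ->
  base (curvatureG q (row_mx a 0) (row_mx b 0) (row_mx c 0)) =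
  curvature g (base q) a b c
  - (inner g (base q) b c *: a - inner g (base q) a c *: b).
Proof.
move=> q0; apply/rowP => l; rewrite /curvature !mxE.
rewrite sum_hor; last first.
  rewrite big1// => j _; rewrite big1// => k _.
  by rewrite row_hr mulr0 !mul0r.
under eq_bigr => i _.
  rewrite sum_hor; last by rewrite big1// => k _; rewrite row_hr mulr0 !mul0r.
  under eq_bigr => j _.
    rewrite sum_hor; last by rewrite row_hr mulr0.
    under eq_bigr do rewrite !row_hh riemann_hhhh//.
    over.
  over.
rewrite /=.
(* Writing the correction term as triple sums reduces the claim to
   equality of the terms. *)
pose s1 := \sum_i (l == i)%:R * (inner g (base q) b c * a 0 i).
pose s2 := \sum_j (l == j)%:R * (inner g (base q) a c * b 0 j).
have <- : s1 = inner g (base q) b c * a 0 l by exact: sum_pick.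
have <- : s2 = inner g (base q) a c * b 0 l by exact: sum_pick.
have -> : s2 = \sum_i \sum_j \sum_k
    (l == j)%:R * g (base q) i k * a 0 i * b 0 j * c 0 k.
  rewrite exchange_big; apply: eq_bigr => j _ /=.
  rewrite innerE mulr_suml mulr_sumr; apply: eq_bigr => i _.
  by rewrite mulr_suml mulr_sumr; apply: eq_bigr => k _; ring.
have -> : s1 = \sum_i \sum_j \sum_k
    (l == i)%:R * g (base q) j k * a 0 i * b 0 j * c 0 k.
  apply: eq_bigr => i _ /=.
  rewrite innerE mulr_suml mulr_sumr; apply: eq_bigr => j _.
  by rewrite mulr_suml mulr_sumr; apply: eq_bigr => k _; ring.
rewrite -!sumrB; apply: eq_bigr => i _; rewrite -!sumrB; apply: eq_bigr => j _.
by rewrite -!sumrB; apply: eq_bigr => k _; ring.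
Qed.

Lemma base_curvature_dr a q : radius q != 0 ->
  base (curvatureG q (row_mx a 0) vert vert) = 0.
Proof.
move=> q0; apply/rowP => l; rewrite /curvature !mxE.
rewrite sum_hor; last first.
  rewrite big1// => j _; rewrite big1// => k _.
  by rewrite row_hr mulr0 !mul0r.
rewrite big1// => i _; rewrite sum_rad; last first.
  by move=> j; rewrite big1// => k _; rewrite row_rh mulr0 mul0r.
rewrite sum_rad; last by move=> j; rewrite row_rh mulr0.
by rewrite riemann_hhrr// !mul0r.
Qed.

Lemma radius_curvature_dr b c q : radius q != 0 ->
  radius (curvatureG q vert (row_mx b 0) (row_mx c 0)) = 0.
Proof.
move=> q0; rewrite /Defs.radius /curvature !mxE.
rewrite sum_rad; last first.
  move=> i; rewrite big1// => j _; rewrite big1// => k _.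
  by rewrite row_rh mulr0 !mul0r.
rewrite sum_hor; last first.
  by rewrite big1// => k _; rewrite row_hr mulr0 !mul0r.
rewrite big1// => j _; rewrite sum_hor; last first.
  by rewrite row_hr mulr0.
by rewrite big1// => k _; rewrite riemann_rrhh// !mul0r.
Qed.

Lemma sectional_cone_lift_dr (U : vfield R n) q : radius q != 0 ->
  sectionalG q (cone_lift U q) (cone_dr q) = 0.
Proof.
move=> q0; rewrite /sectional inner_cone_hor base_curvature_dr//.
by rewrite /inner !mul0mx mxE mulr0 mul0r.
Qed.

Lemma sectional_cone_dr_lift (U : vfield R n) q : radius q != 0 ->
  sectionalG q (cone_dr q) (cone_lift U q) = 0.
Proof.
move=> q0; rewrite /sectional inner_cone_rad radius_curvature_dr//.
by rewrite mul0r.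
Qed.

(** The numerator g (R(u, v) v) u loses the Gram determinant of u and v, which is
    the denominator: this is the - 1. *)
Lemma sectional_cone_lift (U V : vfield R n) q (p := base q) : radius q != 0 ->
  inner g p (U p) (U p) * inner g p (V p) (V p)
    - inner g p (U p) (V p) ^+ 2 != 0 ->
  sectionalG q (cone_lift U q) (cone_lift V q) =
  (sectional g p (U p) (V p) - 1) / radius q ^+ 2.
Proof.
move=> q0; rewrite /cone_lift -/p; set u := U p; set v := V p => D0.
rewrite /sectional !inner_cone_hor base_curvature_cone// -/p.
have bK c : base (row_mx c (0 : 'M[R]_1)) = c by exact: row_mxKl.
rewrite !bK !(curvatureZ, innerBl, innerZl, innerZr).
rewrite (innerC _ p v u) => [|i j]; last exact: gS.
by field; rewrite q0 D0.
Qed.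

End ConeCurvature.

(** * Curvature of the Heisenberg group *)

Section HeisenbergCurvature.
Context {R : realType}.
Implicit Types (p u v w : 'rV[R]_3) (i j k l : 'I_3).

Local Notation g := (@heis_metric R).

(** The degenerate metric dx^2 + dy^2. *)
Definition hdot u v : R := u 0 0 * v 0 0 + u 0 1 * v 0 1.
(** The form dx /\ dy. *)
Definition area u v : R := u 0 0 * v 0 1 - u 0 1 * v 0 0.
(** Half of the contact form omega: the unit covector that annihilates X and Y. *)
Definition theta p u : R := u 0 2 / 2 + cx p * u 0 1 - cy p * u 0 0.
(** The quarter turn of the plane spanned by X and Y, extended by T |-> 0. *)
Definition rot p u : 'rV[R]_3 := u 0 0 *: heisY p - u 0 1 *: heisX p.

Lemma ord3 (P : 'I_3 -> Prop) : P 0 -> P 1 -> P 2 -> forall i, P i.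
Proof.
move=> P0 P1 P2 [[|[|[|//]]] Hi].
- by rewrite (_ : Ordinal Hi = 0)//; apply: val_inj.
- by rewrite (_ : Ordinal Hi = 1)//; apply: val_inj.
- by rewrite (_ : Ordinal Hi = 2)//; apply: val_inj.
Qed.

Lemma sum3 (F : 'I_3 -> R) : \sum_i F i = F 0 + F 1 + F 2.
Proof.
rewrite !big_ord_recr big_ord0 /= add0r.
by congr (F _ + F _ + F _); apply: val_inj.
Qed.

Lemma hdotC u v : hdot u v = hdot v u.
Proof. by rewrite /hdot; ring. Qed.

Lemma areaC u v : area u v = - area v u.
Proof. by rewrite /area; ring. Qed.

Lemma heis_metricE p i j :
  g p i j = hdot 'e_i 'e_j + theta p 'e_i * theta p 'e_j.
Proof.
rewrite /heis_metric /sqform /hdot /theta.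
by elim/ord3: i; elim/ord3: j; rewrite !mxE !big_ord1 !mxE /=; field.
Qed.

Lemma heis_innerE p u v : inner g p u v = hdot u v + theta p u * theta p v.
Proof.
by rewrite innerE !sum3 !heis_metricE /hdot /theta !mxE /=; field.
Qed.

Lemma heis_metric_sym p i j : g p i j = g p j i.
Proof. by rewrite !heis_metricE /hdot; ring. Qed.

Lemma heis_metric_unit p : g p \in unitmx.
Proof.
(* The inverse metric is the sum of the squares of an orthonormal frame. *)
have H : g p *m ((heisX p)^T *m heisX p + (heisY p)^T *m heisY p
    + (heisTt p)^T *m heisTt p) = 1%:M.
  apply/matrixP => i j; rewrite !mxE sum3 !heis_metricE /hdot /theta.
  by elim/ord3: i; elim/ord3: j; rewrite !mxE !big_ord1 !mxE /=; field.
by case: (mulmx1_unit H).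
Qed.

(** Two facts in one: theta is affine in the point, and its derivative is already
    antisymmetric, so it equals half of d theta. *)
Lemma is_derive_theta p v u : is_derive p v (theta ^~ u) (area v u).
Proof.
by apply: is_derive_affine => h; rewrite /theta /area /cx /cy !mxE; ring.
Qed.

Lemma is_derive_rot p v u k :
  is_derive p v (fun q => rot q u 0 k) (- 2 * hdot v u * ('e_2 : 'rV[R]_3) 0 k).
Proof.
apply: is_derive_affine => h.
by rewrite /rot /hdot /heisX /heisY /cx /cy !mxE; ring.
Qed.

Lemma theta_rot p u : theta p (rot p u) = 0.
Proof. by rewrite /theta /rot !mxE /=; field. Qed.

(** So rot is the area form with an index raised by the metric, which is why
    the Christoffel symbols below solve the Levi-Civita equations. *)
Lemma inner_rot p w u : inner g p w (rot p u) = area u w.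
Proof.
by rewrite heis_innerE theta_rot mulr0 /hdot /rot /area !mxE /=; ring.
Qed.

Lemma is_derive_metric p v i j :
  is_derive p v (fun q => g q i j)
   (theta p 'e_i * area v 'e_j + theta p 'e_j * area v 'e_i).
Proof.
under eq_fun do rewrite heis_metricE.
have := is_deriveD (is_derive_cst (hdot 'e_i 'e_j) p v)
  (is_deriveM (is_derive_theta p v 'e_i) (is_derive_theta p v 'e_j)).
by rewrite add0r.
Qed.

(** The derivatives of g = hdot + theta^2 are products of theta and area, and in
    d_i g_jl + d_j g_il - d_l g_ij the terms in area_ij cancel by antisymmetry,
    leaving 2 (theta_i area_jl + theta_j area_il). *)
Lemma heis_christoffelE k i j p : christoffel g k i j p =
  theta p 'e_i * rot p 'e_j 0 k + theta p 'e_j * rot p 'e_i 0 k.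
Proof.
move: k; apply: christoffel_unique; first exact: heis_metric_unit.
move=> l; rewrite /partial.
rewrite !(@derive_val _ _ _ _ _ _ _ (is_derive_metric _ _ _ _)).
have rotl u : \sum_k g p l k * rot p u 0 k = area u 'e_l.
  rewrite -(inner_rot p) /inner -rowE mxE.
  by apply: eq_bigr => k _; rewrite !mxE.
under eq_bigr do rewrite mulrDr mulrCA [X in _ + X]mulrCA.
rewrite big_split /= -!mulr_sumr !rotl /area; ring.
Qed.

(** The curvature R(u, v) w of the Heisenberg group.  The last line comes from
    the products of Christoffel symbols, the others from their derivatives. *)
Definition heis_curv p u v w : 'rV[R]_3 :=
  2 * area u v *: rot p w + area u w *: rot p v - area v w *: rot p u
  + 2 * (theta p u * hdot v w - theta p v * hdot u w) *: 'e_2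
  + theta p w *: (theta p u *: rot p (rot p v) - theta p v *: rot p (rot p u)).

Lemma partial_heis_christoffel m k i j p :
  partial m (christoffel g k i j) p =
  area 'e_m 'e_i * rot p 'e_j 0 k + area 'e_m 'e_j * rot p 'e_i 0 k
  - 2 * (theta p 'e_i * hdot 'e_m 'e_j + theta p 'e_j * hdot 'e_m 'e_i)
    * ('e_2 : 'rV[R]_3) 0 k.
Proof.
rewrite /partial; have -> : christoffel g k i j =
  (theta ^~ 'e_i) * (fun q => rot q 'e_j 0 k)
  + (theta ^~ 'e_j) * (fun q => rot q 'e_i 0 k).
  by apply/funext => q; rewrite heis_christoffelE.
rewrite (@derive_val _ _ _ _ _ _ _ (is_deriveD
  (is_deriveM (is_derive_theta p 'e_m 'e_i) (is_derive_rot p 'e_m 'e_j k))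
  (is_deriveM (is_derive_theta p 'e_m 'e_j) (is_derive_rot p 'e_m 'e_i k)))).
rewrite -![_ *: _]/(_ * _); ring.
Qed.

(** Turns an identity that no longer depends on what the four forms are into one
    about their values. *)
Ltac generalize_forms := repeat match goal with
  | |- context [rot ?p (rot ?p ?u)] => generalize (rot p (rot p u)); intro
  end; repeat match goal with
  | |- context [rot ?p ?u] => generalize (rot p u); intro
  | |- context [theta ?p ?u] => generalize (theta p u); intro
  | |- context [area ?u ?v] => generalize (area u v); intro
  | |- context [hdot ?u ?v] => generalize (hdot u v); intro
  end.

(** In the product of two symbols every term containing theta (rot u) vanishes,
    so that only the terms in rot (rot u) remain. *)
Lemma heis_riemannE l i j k p :
  riemann g l i j k p = heis_curv p 'e_i 'e_j 'e_k 0 l.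
Proof.
rewrite /riemann !partial_heis_christoffel.
have theta_sum u : \sum_m theta p 'e_m * u 0 m = theta p u.
  by rewrite sum3 /theta !mxE /=; ring.
have rot_sum u : \sum_m rot p 'e_m 0 l * u 0 m = rot p u 0 l.
  by rewrite sum3 /rot !mxE /=; ring.
have chr2 a b c : \sum_m christoffel g l a m p * christoffel g m b c p =
    theta p 'e_a * (theta p 'e_b * rot p (rot p 'e_c) 0 l
                    + theta p 'e_c * rot p (rot p 'e_b) 0 l).
  transitivity (\sum_m
     (theta p 'e_a * (theta p 'e_b * (rot p 'e_m 0 l * rot p 'e_c 0 m)
                    + theta p 'e_c * (rot p 'e_m 0 l * rot p 'e_b 0 m))
   + rot p 'e_a 0 l * (theta p 'e_b * (theta p 'e_m * rot p 'e_c 0 m)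
                    + theta p 'e_c * (theta p 'e_m * rot p 'e_b 0 m)))).
    by apply: eq_bigr => m _; rewrite !heis_christoffelE; ring.
  rewrite big_split /= -!mulr_sumr !big_split /= -!mulr_sumr !rot_sum !theta_sum.
  by rewrite !theta_rot; ring.
rewrite sumrB !chr2 /heis_curv (areaC 'e_j 'e_i) (hdotC 'e_j 'e_i).
by generalize_forms; rewrite !mxE; ring.
Qed.

Lemma basis_sum (f : 'rV[R]_3 -> R) w :
  (forall a u v, f (a *: u + v) = a * f u + f v) ->
  \sum_k f 'e_k * w 0 k = f w.
Proof.
move=> fL; have f0 : f 0 = 0.
  by have := fL (- 1) 0 0; rewrite scaler0 addr0 mulN1r addNr.
rewrite [in RHS](row_sum_delta w).
apply: (big_rec2 (fun x y => x = f y)) => // k x y _ ->.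
by rewrite fL mulrC.
Qed.

Lemma theta_lin p a u v : theta p (a *: u + v) = a * theta p u + theta p v.
Proof. by rewrite /theta !mxE; ring. Qed.

Lemma rot_lin p a u v : rot p (a *: u + v) = a *: rot p u + rot p v.
Proof. by apply/rowP => k; rewrite /rot !mxE; ring. Qed.

Lemma hdot_lin a u v w : hdot (a *: u + v) w = a * hdot u w + hdot v w.
Proof. by rewrite /hdot !mxE; ring. Qed.

Lemma area_lin a u v w : area (a *: u + v) w = a * area u w + area v w.
Proof. by rewrite /area !mxE; ring. Qed.

Lemma heis_curv_lin_l p a u u' v w l : heis_curv p (a *: u + u') v w 0 l =
  a * heis_curv p u v w 0 l + heis_curv p u' v w 0 l.
Proof.
rewrite /heis_curv !(theta_lin, rot_lin, hdot_lin, area_lin).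
by generalize_forms; rewrite !mxE; ring.
Qed.

Lemma heis_curv_lin_m p a u v v' w l : heis_curv p u (a *: v + v') w 0 l =
  a * heis_curv p u v w 0 l + heis_curv p u v' w 0 l.
Proof.
rewrite /heis_curv !(areaC u) !(theta_lin, rot_lin, hdot_lin, area_lin).
by generalize_forms; rewrite !mxE; ring.
Qed.

Lemma heis_curv_lin_r p a u v w w' l : heis_curv p u v (a *: w + w') 0 l =
  a * heis_curv p u v w 0 l + heis_curv p u v w' 0 l.
Proof.
rewrite /heis_curv !(areaC u) !(areaC v) !(hdotC u) !(hdotC v).
rewrite !(theta_lin, rot_lin, hdot_lin, area_lin).
by generalize_forms; rewrite !mxE; ring.
Qed.

(** Both sides are trilinear, so they agree because they agree on the coordinate
    fields; the sums over the three indices are resummed one at a time. *)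
Lemma heis_curvatureE p u v w : curvature g p u v w = heis_curv p u v w.
Proof.
apply/rowP => l; rewrite /curvature mxE.
rewrite -(basis_sum _ u (fun a x y => heis_curv_lin_l p a x y v w l)).
apply: eq_bigr => i _.
rewrite -(basis_sum _ v (fun a x y => heis_curv_lin_m p a _ x y w l)) mulr_suml.
apply: eq_bigr => j _.
rewrite -(basis_sum _ w (fun a x y => heis_curv_lin_r p a _ _ x y l)) !mulr_suml.
by apply: eq_bigr => k _; rewrite heis_riemannE; ring.
Qed.

Lemma heis_inner_sym p u v : inner g p u v = inner g p v u.
Proof. by apply: innerC => i j; exact: heis_metric_sym. Qed.

(** The only negative contribution is that of the area which u and v span in
    the (x, y)-plane, as O'Neill's formula predicts for the Riemannian submersion
    onto that flat plane. *)
Lemma heis_sectional_num p u v :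
  inner g p (curvature g p u v v) u =
  let w := theta p u *: v - theta p v *: u in hdot w w - 3 * area u v ^+ 2.
Proof.
have innerT : inner g p u 'e_2 = theta p u / 2.
  by rewrite heis_innerE /hdot /theta !mxE /=; field.
have innerJJ x : inner g p u (rot p (rot p x)) = - hdot u x.
  by rewrite inner_rot /area /hdot /rot !mxE /=; ring.
rewrite heis_curvatureE heis_inner_sym /heis_curv /=.
rewrite !(innerDr, innerNr, innerZr, innerJJ, inner_rot, innerT).
by rewrite /area /hdot !mxE; field.
Qed.

Definition orthonormal p u v :=
  [/\ inner g p u u = 1, inner g p v v = 1 & inner g p u v = 0].

Lemma heis_metric_derivable i j k p : derivable (fun q => g q i j) p 'e_k.
Proof. by apply: ex_derive; exact: is_derive_metric. Qed.

Lemma sectional_heis_cone (q : 'rV[R]_(3 + 1)) (U V : vfield R 2)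
    (p := base q) : radius q != 0 -> orthonormal p (U p) (V p) ->
  sectional (@heis_cone_metric R) q (cone_lift U q) (cone_lift V q) =
  (inner g p (curvature g p (U p) (V p) (V p)) (U p) - 1) / radius q ^+ 2.
Proof.
move=> q0 [uu vv uv].
have D1 : inner g p (U p) (U p) * inner g p (V p) (V p)
    - inner g p (U p) (V p) ^+ 2 = 1.
  by rewrite uu vv uv expr0n/= subr0 mulr1.
apply: etrans (sectional_cone_lift g heis_metric_unit heis_metric_sym
  heis_metric_derivable U V q q0 _) _; first by rewrite D1 oner_eq0.
by rewrite /sectional D1 divr1.
Qed.

Lemma orthonormalC p u v : orthonormal p u v -> orthonormal p v u.
Proof. by case=> uu vv uv; split; rewrite // heis_inner_sym. Qed.

Lemma heis_orthonormal_XY p : orthonormal p (heisX p) (heisY p).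
Proof.
by split; rewrite heis_innerE /hdot /theta /heisX /heisY !mxE /=; field.
Qed.

Lemma heis_orthonormal_XT p : orthonormal p (heisX p) (heisTt p).
Proof.
by split; rewrite heis_innerE /hdot /theta /heisX /heisTt /heisT !mxE /=; field.
Qed.

Lemma heis_orthonormal_YT p : orthonormal p (heisY p) (heisTt p).
Proof.
by split; rewrite heis_innerE /hdot /theta /heisY /heisTt /heisT !mxE /=; field.
Qed.

Lemma heis_sectional_numC p u v : inner g p (curvature g p u v v) u =
  inner g p (curvature g p v u u) v.
Proof. by rewrite !heis_sectional_num /= /area /hdot !mxE; ring. Qed.

Lemma heis_sectional_XY p :
  inner g p (curvature g p (heisX p) (heisY p) (heisY p)) (heisX p) = - 3.
Proof.
by rewrite heis_sectional_num /= /hdot /area /theta /heisX /heisY !mxE /=; field.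
Qed.

Lemma heis_sectional_XT p :
  inner g p (curvature g p (heisX p) (heisTt p) (heisTt p)) (heisX p) = 1.
Proof.
rewrite heis_sectional_num /= /hdot /area /theta /heisX /heisTt /heisT !mxE /=.
by field.
Qed.

Lemma heis_sectional_YT p :
  inner g p (curvature g p (heisY p) (heisTt p) (heisTt p)) (heisY p) = 1.
Proof.
rewrite heis_sectional_num /= /hdot /area /theta /heisY /heisTt /heisT !mxE /=.
by field.
Qed.

End HeisenbergCurvature.

Theorem proposition4p1 (R : realType) (p : 'rV[R]_3) (r : R) (hr : 0 < r) :
  let q : 'rV[R]_4 := cone_pt p r in
  let K := sectional (@heis_cone_metric R) q in
  (forall u v : 'rV[R]_4,
     u \in cone_frame q -> v \in cone_frame q -> u != v ->
     <<[:: u; v]>>%VS != <<[:: coneX q; coneY q]>>%VS ->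
     K u v = 0)
  /\ K (coneX q) (coneY q) = - (4 / r ^+ 2)
  /\ - (4 / r ^+ 2) < 0.
Proof.
move=> q K.
have qr : @Defs.radius R 2 q = r by rewrite /Defs.radius row_mxKr mxE.
have q0 : @Defs.radius R 2 q != 0 by rewrite qr gt_eqF.
have Kflat (U V : vfield R 2) :
    (forall x, orthonormal x (U x) (V x)) ->
    (forall x, inner (@heis_metric R) x
       (curvature (@heis_metric R) x (U x) (V x) (V x)) (U x) = 1) ->
    K (cone_lift U q) (cone_lift V q) = 0.
  move=> UV KUV; rewrite /K [LHS](sectional_heis_cone _ _ _ q0 (UV _)).
  by rewrite KUV subrr mul0r.
have KR (U : vfield R 2) : K (cone_lift U q) (coneR q) = 0.
  exact: sectional_cone_lift_dr _ heis_metric_unit heis_metric_sym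
    heis_metric_derivable _ _ q0.
have RK (U : vfield R 2) : K (coneR q) (cone_lift U q) = 0.
  exact: sectional_cone_dr_lift _ heis_metric_unit heis_metric_sym
    heis_metric_derivable _ _ q0.
split; last split.
- move=> u v; rewrite !inE => /or4P[]/eqP-> /or4P[]/eqP->;
    rewrite ?eqxx// => _ h.
  + apply: Kflat; [exact: heis_orthonormal_XT|exact: heis_sectional_XT].
  + exact: KR.
  (* The plane of X and Y with its vectors in the other order is excluded. *)
  + case/eqP: h; apply: eq_span => z; rewrite !inE; exact: orbC.
  + apply: Kflat; [exact: heis_orthonormal_YT|exact: heis_sectional_YT].
  + exact: KR.
  + apply: Kflat => x; first exact/orthonormalC/heis_orthonormal_XT.
    by rewrite heis_sectional_numC heis_sectional_XT.
  + apply: Kflat => x; first exact/orthonormalC/heis_orthonormal_YT.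
    by rewrite heis_sectional_numC heis_sectional_YT.
  + exact: KR.
  + exact: RK.
  + exact: RK.
  + exact: RK.
- rewrite /K [LHS](sectional_heis_cone _ _ _ q0 (heis_orthonormal_XY _)).
  by rewrite heis_sectional_XY qr; field; rewrite gt_eqF.
- by rewrite oppr_lt0 divr_gt0// exprn_gt0.
Qed.
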